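(* Let $U=R$ be a ring with $1$, let $K\subset R$ be a (not necessarily commutative) subfield with $1\in K$, consider $U=R$ as a left vector space over $K$, and let $\varphi:K\to\mathrm{End}_K(U)$ be given by $u\cdot k:=uk$. Let $\Phi$ be the associated projective representation of $\mathbb{P}(K)$ in $\mathbb{P}(K,U\times U)$, so that $\mathbb{P}(K)^\Phi=\{R(x,y)\mid (x,y)\in K^2\setminus\{(0,0)\}\}$. Then $\mathbb{P}(K)^\Phi$ is a regulus in $\mathbb{P}(K,U\times U)$ if, and only if, there exists a basis $(b_i)_{i\in I}$ of the left vector space $U=R$ over $K$ such that each $b_i$ centralizes $K$, i.e. $b_ik=kb_i$ holds for all $i\in I$, $k\in K$.
   Context: Conventions: ''field'' means a division ring, not necessarily commutative. $\mathbb{P}(K,U\times U)$ is the projective space of subspaces of the left $K$-vector space $U\times U$. $\mathbb{P}(K)$ is the set of $1$-dimensional subspaces $K(k,l)$ of the left vector space $K^2$. The projective representation associated to $\varphi$ (equivalently, to the $(K,K)$-bimodule $U$) is the mapping $\Phi$ with $K(k,l)^\Phi=\{(u\cdot k,u\cdot l)\mid u\in U\}$, a subspace of $U\times U$. In the present situation $U=R$, so $K(k,l)^\Phi=R(k,l)$; the paper identifies $\mathbb{P}(K)$ with the set of these submodules of $R^2$ and writes $\mathbb{P}(K)^\Phi=\mathbb{P}(K)$. Regulus: given a basis $(c_i)_{i\in I}$ of the left $K$-vector space $U$, the set of all subspaces $$\Big\{\Big(\sum_{i\in I}x_ikc_i,\ \sum_{i\in I}x_ilc_i\Big)\ \Big|\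 x_i\in K,\ \text{almost all } x_i=0\Big\},\qquad K(k,l)\in\mathbb{P}(K),$$ is a regulus in $\mathbb{P}(K,U\times U)$ (here $x_ikc_i$ uses only the left $K$-vector space structure), and the reguli in $\mathbb{P}(K,U\times U)$ are exactly the sets of subspaces that are projectively equivalent to it, i.e. its images under $K$-linear automorphisms of $U\times U$. *)

(* Defs.v *)
From HB Require Import structures.
From mathcomp Require Import all_boot all_algebra.
From mathcomp Require Import finmap.
From mathcomp Require Import boolp classical_sets.

Set Implicit Arguments.
Unset Strict Implicit.
Unset Printing Implicit Defensive.

Import GRing.Theory.
Local Open Scope fset_scope.
Local Open Scope classical_set_scope.
Local Open Scope ring_scope.

(* A field in the sense of the paper: multiplication need not commute. *)
Definition division_ring (K : unitRingType) : Prop :=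
  forall x : K, x != 0 -> x \is a GRing.unit.

Section Basis.
Variables (K : unitRingType) (U : lmodType K) (I : choiceType).

(* The index type may be infinite; coefficient families are zero almost
   everywhere. *)
Definition lincomb (c : I -> U) (x : {fsfun I -> K with 0}) : U :=
  \sum_(i <- finsupp x) x i *: c i.

Definition is_basis (c : I -> U) : Prop :=
  (forall x : {fsfun I -> K with 0}, lincomb c x = 0 -> forall i, x i = 0) /\
  (forall u : U, exists x : {fsfun I -> K with 0}, u = lincomb c x).

End Basis.

Section ProjectiveLine.
Variable K : unitRingType.

(* The points of P(K) are the one-dimensional subspaces K(k,l), (k,l) <> 0.
   Sets indexed by P(K) are written below as indexed by the nonzero pairs (k,l);
   proj_rep_point and std_space_point show that the result depends only on the
   point K(k,l). *)
Definition point (p : K * K) : set (K * K) :=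
  [set (a * p.1, a * p.2) | a in [set: K]].

Definition nonzero_pairs : set (K * K) := [set p | p != (0, 0)].

End ProjectiveLine.

Section ProjectiveRepresentation.
Variables (K : unitRingType) (U : lmodType K) (phi : K -> {linear U -> U}).

Definition proj_rep (p : K * K) : set (U * U) :=
  [set (phi p.1 u, phi p.2 u) | u in [set: U]].

Definition proj_rep_image : set (set (U * U)) :=
  [set proj_rep p | p in @nonzero_pairs K].

Lemma proj_rep_point (p q : K * K) :
  (forall k l u, phi (k * l) u = phi l (phi k u)) ->
  point p = point q -> proj_rep p = proj_rep q.
Proof.
move=> phiM.
have sub p1 p2 : point p1 p2 -> proj_rep p2 `<=` proj_rep p1.
  move=> [a _ <-] _ [u _ <-] /=.
  by exists (phi a u); rewrite // !phiM.
have pt p1 : point p1 p1 by exists 1; rewrite // !mul1r -surjective_pairing.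
by move=> e; rewrite eqEsubset; split; apply: sub; rewrite ?e // -e.
Qed.

End ProjectiveRepresentation.

Section Regulus.
Variables (K : unitRingType) (U : lmodType K).

Definition std_space (I : choiceType) (c : I -> U) (p : K * K) : set (U * U) :=
  [set (\sum_(i <- finsupp x) (x i * p.1) *: c i,
        \sum_(i <- finsupp x) (x i * p.2) *: c i)
  | x in [set: {fsfun I -> K with 0}]].

Definition std_regulus (I : choiceType) (c : I -> U) : set (set (U * U)) :=
  [set std_space c p | p in @nonzero_pairs K].

Definition is_regulus (S : set (set (U * U))) : Prop :=
  exists (I : choiceType) (c : I -> U) (f : {linear (U * U)%type -> (U * U)%type}),
    [/\ is_basis c, bijective f & S = [set f @` X | X in std_regulus c]].

Lemma std_space_point (I : choiceType) (c : I -> U) (p q : K * K) :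
  point p = point q -> std_space c p = std_space c q.
Proof.
have sub p1 p2 : point p1 p2 -> std_space c p2 `<=` std_space c p1.
  move=> [a _ <-] _ [x _ <-] /=.
  pose y : {fsfun I -> K with 0} := [fsfun i in finsupp x => x i * a].
  have yE i : y i = x i * a.
    by rewrite fsfunE; case: finsuppP => //; rewrite mul0r.
  have sumE (b : K) : \sum_(i <- finsupp y) (y i * b) *: c i =
      \sum_(i <- finsupp x) (x i * (a * b)) *: c i.
    rewrite (big_fset_incl _ (A := finsupp y) (B := finsupp x)).
    - by apply: eq_bigr => i _; rewrite yE mulrA.
    - by apply/fsubsetP => i; rewrite !mem_finsupp yE; apply: contra => /eqP ->;
        rewrite mul0r.
    - by move=> i _ /fsfun_dflt ->; rewrite mul0r scale0r.
  by exists y; rewrite // !sumE.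
have pt p1 : point p1 p1 by exists 1; rewrite // !mul1r -surjective_pairing.
by move=> e; rewrite eqEsubset; split; apply: sub; rewrite ?e // -e.
Qed.

End Regulus.

Section RingExtension.
(* A left algebra R over K is a ring R with 1 together with a ring morphism
   k |-> k%:A from K to R such that k *: u = k%:A * u. For a division ring K this
   morphism is injective, so this is the same as K being a subfield of R
   containing 1, with R regarded as a left vector space over K; the element
   k of K, seen in R, is k%:A. *)
Variables (K : unitRingType) (R : lalgType K).

Lemma subfield_scaleE (k : K) (u : R) : k *: u = k%:A * u.
Proof. by rewrite -scalerAl mul1r. Qed.

Lemma subfield_inj : division_ring K -> injective (fun k : K => k%:A : R).
Proof.
move=> fK k l /= ekl; apply/eqP; rewrite -subr_eq0; apply/negPn/negP => /fK.
move=> /mulVr e; move: (oner_neq0 R).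
by rewrite -[X in X != 0]scale1r -e -scalerA scalerBl ekl subrr scaler0 eqxx.
Qed.

(* u . k = u k; this map is K-linear for the left structure only. *)
Definition right_mult (k : K) : {linear R -> R} := (k%:A : R) \o* idfun.

Lemma right_multE (k : K) (u : R) : right_mult k u = u * k%:A.
Proof. by []. Qed.

Lemma right_multM (k l : K) (u : R) :
  right_mult (k * l) u = right_mult l (right_mult k u).
Proof. by rewrite !right_multE -mulrA -subfield_scaleE scalerA. Qed.

End RingExtension.

(* Main.v *)
(** Extend the basis [c] by [T k (c i) = k *: c i]: the standard regulus consists of
    the spaces [{(T p.1 u, T p.2 u)}], and if the [c i] centralize [K] this is right
    multiplication, which gives one direction with the identity collineation.
    Conversely, let [f] carry the spaces of [q1], [q2], [q3] to [R(1,0)], [R(0,1)],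
    [R(1,1)]. In the coordinates of [K^2] with respect to [q1], [q2], [f] is a
    diagonal map, and comparing with [R(1,1)] and [R(1,k)] yields a [K]-linear
    bijection [h] from [U] to [R] such that for every [k] there is [t] with
    [h u * k = h (T t u)]. Writing [1 = h (\sum_i x_i c_i)] and picking [x_i <> 0]
    forces [t = x_i^-1 k x_i], so that the [x_i h (c j)] form the wanted basis. *)
From HB Require Import structures.
Require Import Defs.
From mathcomp Require Import all_boot all_algebra.
From mathcomp Require Import finmap.
From mathcomp Require Import boolp classical_sets.

Set Implicit Arguments.
Unset Strict Implicit.
Unset Printing Implicit Defensive.

Import GRing.Theory.
Local Open Scope ring_scope.

(** * Coordinates in a left vector space and the right action of [K] given by a basis *)

Section Coordinates.
Variables (K : unitRingType) (I : choiceType).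
Implicit Types x y : {fsfun I -> K with 0}.

(** Families with different supports can only be compared over a common finite set; the terms added
    have coefficient 0. *)
Lemma lincomb_widen (V : lmodType K) (g : I -> V) x (A : {fset I}) :
  (finsupp x `<=` A)%fset -> lincomb g x = \sum_(i <- A) x i *: g i.
Proof.
move=> sxA; apply: (big_fset_incl _ sxA) => i _.
by move=> /fsfun_dflt ->; rewrite scale0r.
Qed.

Definition fsfun_comb (a : K) x y : {fsfun I -> K with 0} :=
  [fsfun i in (finsupp x `|` finsupp y)%fset => a * x i + y i].

Lemma fsfun_combE a x y i : fsfun_comb a x y i = a * x i + y i.
Proof.
rewrite fsfunE in_fsetU; case: (finsuppP x i) => // _; case: finsuppP => // _.
by rewrite mulr0 addr0.
Qed.

Lemma lincomb_comb (V : lmodType K) (g : I -> V) a x y :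
  lincomb g (fsfun_comb a x y) = a *: lincomb g x + lincomb g y.
Proof.
pose A := (finsupp x `|` finsupp y)%fset.
rewrite !(lincomb_widen _ (A := A)) ?fsubsetUl ?fsubsetUr //.
  rewrite scaler_sumr -big_split; apply: eq_bigr => i _ /=.
  by rewrite fsfun_combE scalerDl scalerA.
apply/fsubsetP => i; rewrite mem_finsupp fsfun_combE in_fsetU !mem_finsupp.
by apply: contraNT; rewrite negb_or !negbK => /andP[/eqP-> /eqP->]; rewrite mulr0 addr0.
Qed.

Variables (U : lmodType K) (c : I -> U).
Hypothesis hc : is_basis c.

Lemma lincomb_inj : injective (lincomb c).
Proof.
move=> x y exy; apply/fsfunP => i.
have : fsfun_comb (-1) x y i = 0.
  by apply: hc.1; rewrite lincomb_comb exy scaleN1r addNr.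
by rewrite fsfun_combE mulN1r addrC => /subr0_eq.
Qed.

Definition coord (u : U) : {fsfun I -> K with 0} := projT1 (cid (hc.2 u)).

Lemma coordK : cancel coord (lincomb c).
Proof. by move=> u; rewrite /coord; case: cid. Qed.

Lemma lincombK : cancel (lincomb c) coord.
Proof. by move=> x; apply: lincomb_inj; rewrite coordK. Qed.

Lemma coord_comb a u v : coord (a *: u + v) = fsfun_comb a (coord u) (coord v).
Proof. by apply: lincomb_inj; rewrite lincomb_comb !coordK. Qed.

Lemma coordZ a u i : coord (a *: u) i = a * coord u i.
Proof.
have c0 : coord 0 i = 0 by apply: hc.1; rewrite coordK.
by rewrite -[a *: u]addr0 coord_comb fsfun_combE c0 addr0.
Qed.

Lemma coord_basis i : coord (c i) = [fsfun j in [fset i]%fset => 1].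
Proof.
apply: lincomb_inj; rewrite coordK (lincomb_widen _ (A := [fset i]%fset)).
  by rewrite big_seq_fset1 fsfunE in_fset1 eqxx scale1r.
by apply/fsubsetP => j; rewrite mem_finsupp fsfunE; case: ifP; rewrite ?eqxx.
Qed.

Section Extension.
Variables (V : lmodType K) (g : I -> V).

Definition basis_ext (u : U) : V := lincomb g (coord u).

Lemma basis_ext_is_linear : linear basis_ext.
Proof. by move=> a u v; rewrite /basis_ext coord_comb lincomb_comb. Qed.

HB.instance Definition _ :=
  GRing.isLinear.Build K U V *:%R basis_ext basis_ext_is_linear.

Lemma basis_extE i : basis_ext (c i) = g i.
Proof.
rewrite /basis_ext coord_basis (lincomb_widen _ (A := [fset i]%fset)).
  by rewrite big_seq_fset1 fsfunE in_fset1 eqxx scale1r.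
by apply/fsubsetP => j; rewrite mem_finsupp fsfunE; case: ifP; rewrite ?eqxx.
Qed.

End Extension.

Lemma linear_lincomb (V : lmodType K) (g : {linear U -> V}) x :
  g (lincomb c x) = lincomb (g \o c) x.
Proof. by rewrite raddf_sum; apply: eq_bigr => i _ /=; rewrite linearZ. Qed.

Lemma eq_linear_basis (V : lmodType K) (g h : {linear U -> V}) :
  (forall i, g (c i) = h (c i)) -> g =1 h.
Proof.
move=> egh u; rewrite -(coordK u) !linear_lincomb.
by apply: eq_bigr => i _ /=; rewrite egh.
Qed.

Lemma is_basis_bij (V : lmodType K) (g : {linear U -> V}) :
  bijective g -> is_basis (g \o c).
Proof.
move=> [h gK hK]; split.
  move=> x; rewrite -linear_lincomb => e; apply: hc.1.
  by apply: (can_inj gK); rewrite e raddf0.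
by move=> v; exists (coord (h v)); rewrite -linear_lincomb coordK hK.
Qed.

(* The right action of [K] on [U] which makes the basis vectors centralize [K]. *)
Definition basis_act (k : K) : {linear U -> U} := basis_ext (fun i => k *: c i).

Lemma basis_actE k i : basis_act k (c i) = k *: c i.
Proof. exact: basis_extE. Qed.

Lemma basis_act1 u : basis_act 1 u = u.
Proof.
by apply: (eq_linear_basis (h := idfun)) => i; rewrite basis_actE scale1r.
Qed.

Lemma basis_act_lincomb k x :
  basis_act k (lincomb c x) = \sum_(i <- finsupp x) (x i * k) *: c i.
Proof.
by rewrite linear_lincomb; apply: eq_bigr => i _; rewrite /= basis_actE scalerA.
Qed.

(** Left linearity pulls [k] out of [basis_act l (k *: c i)], so [l] lands next to [c i]:
    composition reverses products, as befits a right action. *)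
Lemma basis_actM k l u : basis_act (k * l) u = basis_act l (basis_act k u).
Proof.
apply: (eq_linear_basis (h := basis_act l \o basis_act k)) => i /=.
by rewrite !basis_actE linearZ /= basis_actE scalerA.
Qed.

Lemma basis_actD k l u : basis_act (k + l) u = basis_act k u + basis_act l u.
Proof.
rewrite -(coordK u) !basis_act_lincomb -big_split; apply: eq_bigr => i _.
by rewrite mulrDr scalerDl.
Qed.

Lemma basis_act0 u : basis_act 0 u = 0.
Proof. by apply: (addrI (basis_act 0 u)); rewrite -basis_actD !addr0. Qed.

(** Scalars act on coordinates from the left by [coordZ], the basis action from the right; comparing
    the two later produces a conjugation in [K]. *)
Lemma coord_act k u i : coord (basis_act k u) i = coord u i * k.
Proof.
have e : basis_act k u =
    lincomb c [fsfun j in finsupp (coord u) => coord u j * k].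
  rewrite -[u in LHS]coordK basis_act_lincomb.
  rewrite (lincomb_widen _ (A := finsupp (coord u))).
    rewrite [LHS]big_seq [RHS]big_seq.
    by apply: eq_bigr => j ju; rewrite fsfunE ju.
  by apply/fsubsetP => j; rewrite mem_finsupp fsfunE; case: ifP; rewrite ?eqxx.
by rewrite e lincombK fsfunE; case: finsuppP; rewrite ?mul0r.
Qed.

Lemma std_space_act (p : K * K) : std_space c p = proj_rep basis_act p.
Proof.
rewrite eqEsubset; split => _ [x _ <-] /=.
  by exists (lincomb c x); rewrite // !basis_act_lincomb.
by exists (coord x); rewrite // -!basis_act_lincomb coordK.
Qed.

End Coordinates.

(** * From a collineation to a centralizing basis *)

Section DivisionRing.
Variables (K : unitRingType) (hK : division_ring K).

Lemma dependent_or_spanning (p q : K * K) : p != (0, 0) ->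
  (exists z, q = (z * p.1, z * p.2)) \/
  (forall r : K * K, exists x y, r = (x * p.1 + y * q.1, x * p.2 + y * q.2)).
Proof.
case: p q => [a b] [c d] /= p0.
have [a0|/hK ua] := eqVneq a 0.
  have /hK ub : b != 0 by apply: contraNneq p0 => ->; rewrite a0.
  have [c0|/hK uc] := eqVneq c 0.
    by left; exists (d / b); rewrite a0 c0 mulr0 divrK.
  right=> -[r s]; exists ((s - r / c * d) / b), (r / c).
  by rewrite a0 /= mulr0 add0r !divrK // subrK.
(* Elimination with scalars on the left: [q - (c / a) p] has first entry 0 and this second entry,
   which serves as the next pivot when it is nonzero. *)
have [e|/hK ue] := eqVneq (d - c / a * b) 0.
  by left; exists (c / a); rewrite divrK // -(subr0_eq e).
right=> -[r s]; set e := d - _ in ue.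
pose y := (s - r / a * b) / e.
exists ((r - y * c) / a), y; rewrite /= divrK // subrK; congr pair.
have -> : d = e + c / a * b by rewrite /e subrK.
rewrite mulrDr divrK // !mulrBl !mulrA addrACA addNr addr0.
by rewrite addrC subrK.
Qed.

Variables (U : lmodType K) (R : lalgType K) (I : choiceType) (c : I -> U).
Hypothesis hc : is_basis c.
Local Notation T := (basis_act hc).

Lemma basis_act_inj k : k != 0 -> injective (T k).
Proof.
move=> /hK uk u v /(congr1 (T k^-1)).
by rewrite -!basis_actM divrr // !basis_act1.
Qed.

Variable f : {linear (U * U)%type -> (R * R)%type}.
Hypothesis fI : injective f.
Hypothesis fS : forall p : K * K, p != (0, 0) ->
  exists2 q : K * K, q != (0, 0) &
    proj_rep (@right_mult K R) p = [set f X | X in proj_rep T q]%classic.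

(** Indexing by pairs instead of points makes [F] additive in [q], so it can be expanded along two
    independent pairs. *)
Let F (q : K * K) (u : U) : R * R := f (T q.1 u, T q.2 u).

Lemma proj_rep_factor (p : K * K) : p != (0, 0) ->
  exists2 q : K * K, q != (0, 0) &
    (forall u, exists v, F q u = (v * p.1%:A, v * p.2%:A)) /\
    (forall v, exists u, F q u = (v * p.1%:A, v * p.2%:A)).
Proof.
move=> /fS[q q0 e]; exists q => //; split=> [u|v].
  have : [set f X | X in proj_rep T q]%classic (F q u).
    by exists (T q.1 u, T q.2 u) => //; exists u.
  by rewrite -e => -[v _ <-]; exists v.
have : proj_rep (@right_mult K R) p (v * p.1%:A, v * p.2%:A) by exists v.
by rewrite e => -[_ [u _ <-] <-]; exists u.
Qed.

Lemma collineation_twist :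
  exists h : {linear U -> R}, bijective h /\
    (forall k : K, exists t : K, forall u, h u * k%:A = h (T t u)).
Proof.
have n10 : (1, 0) != (0, 0) :> K * K by rewrite xpair_eqE oner_eq0.
have n01 : (0, 1) != (0, 0) :> K * K by rewrite xpair_eqE oner_eq0 andbF.
have n1k k : (1, k) != (0, 0) :> K * K by rewrite xpair_eqE oner_eq0.
have [q1 q1n [F1 S1]] := proj_rep_factor n10.
have [q2 q2n [F2 S2]] := proj_rep_factor n01.
have FM q z u : F (z * q.1, z * q.2) u = F q (T z u).
  by rewrite /F /= !basis_actM.
have F0 q : F q 0 = 0 by rewrite /F !raddf0.
(* If [q2] were a left multiple of [q1], the point [(0, 1)] would lie in [R(1,0)]. *)
have span : forall r : K * K,
    exists x y, r = (x * q1.1 + y * q2.1, x * q1.2 + y * q2.2).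
  case: (dependent_or_spanning q2 q1n) => // -[z e].
  have [u] := S2 1; rewrite e FM; have [v ->] := F1 (T z u).
  by rewrite /= scale0r scale1r !mulr0 !mulr1 => -[_ /esym/eqP]; rewrite oner_eq0.
have FD x y u : F (x * q1.1 + y * q2.1, x * q1.2 + y * q2.2) u =
    F q1 (T x u) + F q2 (T y u).
  by rewrite /F -raddfD /= !basis_actD !basis_actM.
pose h1 u := (F q1 u).1; pose h2 u := (F q2 u).2.
have F1E u : F q1 u = (h1 u, 0).
  by rewrite /h1; have [v ->] := F1 u; rewrite /= scale0r mulr0.
have F2E u : F q2 u = (0, h2 u).
  by rewrite /h2; have [v ->] := F2 u; rewrite /= scale0r mulr0.
have h1lin : linear h1.
  move=> a u v; rewrite /h1; have -> : F q1 (a *: u + v) = a *: F q1 u + F q1 v.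
    by rewrite /F -linearP !linearP.
  by [].
(* Injectivity of [f] reduces this to injectivity of [T] at a nonzero entry of [q1]. *)
have h1I u : h1 u = 0 -> u = 0.
  move=> e; have : F q1 u = F q1 0 by rewrite F0 F1E e.
  move=> /fI[e1 e2]; case: (eqVneq q1.1 0) => [a0|/basis_act_inj]; last exact.
  case: (eqVneq q1.2 0) => [b0|/basis_act_inj]; last exact.
  by move: q1n; rewrite [q1]surjective_pairing a0 b0 eqxx.
have h1bij : bijective h1.
  have /choice[g gK] : forall v, exists u, h1 u = v.
    by move=> v; have [u e] := S1 v; exists u; rewrite /h1 e /= scale1r mulr1.
  exists g => // u; apply/eqP; rewrite -subr_eq0; apply/eqP; apply: h1I.
  by rewrite -scaleN1r addrC h1lin gK scaleN1r addNr.
(* [f] maps the space of [x q1 + y q2] to [R(1,k)]. *)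
have slope k : exists x y, [/\ x != 0, (k != 0 -> y != 0) &
    forall u, h1 (T x u) * k%:A = h2 (T y u)].
  have [q qn [Fq Sq]] := proj_rep_factor (n1k k).
  have [x [y e]] := span q; rewrite {q qn}e in Fq Sq.
  (* The preimage [u1] of [(1, k)] satisfies [h1 (T x u1) = 1] and [h2 (T y u1) = k%:A], which
     forces [x], and [y] if [k != 0], to be nonzero. *)
  have [u1] := Sq 1; rewrite FD F1E F2E /= => -[]; rewrite addr0 add0r.
  rewrite scale1r mulr1 mul1r => e1 e2.
  have h10 : h1 0 = 0 by rewrite /h1 F0.
  have h20 : h2 0 = 0 by rewrite /h2 F0.
  exists x, y; split.
  - by apply: contra_eq_neq e1 => ->; rewrite basis_act0 h10 eq_sym oner_neq0.
  - move=> k0; apply: contra_eq_neq e2 => ->; rewrite basis_act0 h20 eq_sym.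
    by apply: contra_neq k0 => k0; apply: (subfield_inj hK (R := R)); rewrite /= scale0r.
  move=> u; have [v] := Fq u; rewrite FD F1E F2E /= => -[].
  by rewrite addr0 add0r scale1r mulr1 => -> ->.
have [x [y [/hK ux /(_ (oner_neq0 _))/hK uy h12]]] := slope 1.
pose h : {linear U -> R} := HB.pack h1 (GRing.isLinear.Build _ _ _ _ h1 h1lin).
exists h; split => // k; have [z [w [/hK uz _ hk]]] := slope k.
(* Slope [k] gives [h1 u * k%:A = h2 (T w (T z^-1 u))], and slope 1 replaces [h2] by [h1] composed
   with [T x] and [T y^-1]. Composition reverses the factors. *)
exists (z^-1 * w * y^-1 * x) => u; rewrite /h /=.
have e1 := h12 (T y^-1 (T w (T z^-1 u))).
rewrite scale1r mulr1 -(basis_actM hc y^-1 y) mulVr // basis_act1 in e1.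
have e2 := hk (T z^-1 u); rewrite -(basis_actM hc z^-1 z) mulVr // basis_act1 in e2.
by rewrite e2 -e1 !basis_actM.
Qed.

Lemma centralizing_basis :
  exists b : I -> R, is_basis b /\ (forall i k, b i * k%:A = k%:A * b i).
Proof.
have [h [[g hK' gK] ht]] := collineation_twist.
pose v := g 1.
have [i xi] : exists i, coord hc v i != 0.
  apply: contrapT => /forallNP x0; have v0 : v = 0.
    rewrite -(coordK hc v) /lincomb big1_seq // => i _.
    by have /negP/negPn/eqP-> := x0 i; rewrite scale0r.
  by have := gK 1; rewrite -/v v0 raddf0 => /esym/eqP; rewrite oner_eq0.
set x := coord hc v i in xi; have ux := hK xi.
(* As [h v = 1], both [T t v] and [k *: v] are mapped to [k%:A], hence are equal; now compare their
   coordinates at [i]. *)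
have tE k t : (forall u, h u * k%:A = h (T t u)) -> x * t = k * x.
  move=> /(_ v); rewrite gK mul1r => e.
  have : T t v = k *: v by apply: (can_inj hK'); rewrite -e linearZ /= gK.
  by move=> /(congr1 (fun u => coord hc u i)); rewrite coord_act coordZ.
have hx : bijective (h \o T x).
  exists (T x^-1 \o g) => u /=; first by rewrite hK' -basis_actM divrr // basis_act1.
  by rewrite -basis_actM mulVr // basis_act1 gK.
(* Rescaling [c j] to [x *: c j] undoes the conjugation: [T t] sends it to
   [(x * t) *: c j = (k * x) *: c j], with the same [x] for every [k]. *)
exists (h \o T x \o c); split; first exact: is_basis_bij hx.
move=> j k /=; have [t e] := ht k; rewrite e -subfield_scaleE.
have -> : T t (T x (c j)) = k *: T x (c j); last by rewrite linearZ.
by rewrite !basis_actE linearZ /= basis_actE !scalerA (tE k t e).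
Qed.

End DivisionRing.

Theorem theorem4p4 (K : unitRingType) (hK : division_ring K) (R : lalgType K) :
  is_regulus (proj_rep_image (@right_mult K R)) <->
  exists (I : choiceType) (b : I -> R),
    is_basis b /\ (forall (i : I) (k : K), b i * k%:A = k%:A * b i).
Proof.
split=> [[I [c [f [hc fbij e]]]]|[I [b [hb bC]]]].
  exists I; apply: (@centralizing_basis K hK R R I c hc f (bij_inj fbij)) => p p0.
  have : proj_rep_image (@right_mult K R) (proj_rep (@right_mult K R) p).
    by exists p.
  rewrite e => -[_ [q q0 <-] <-]; exists q => //.
  by rewrite (std_space_act hc).
exists I, b, idfun; split=> //; first by exists idfun.
have std p : std_space b p = proj_rep (@right_mult K R) p.
  (* Both maps are left linear, and centralizing [K] makes them agree on the basis. *)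
  have actE k u : basis_act hb k u = right_mult R k u.
    apply: (eq_linear_basis hb) => i.
    by rewrite basis_actE right_multE bC -subfield_scaleE.
  rewrite (std_space_act hb) eqEsubset.
  by split=> _ [u _ <-]; exists u; rewrite // !actE.
rewrite eqEsubset; split=> [_ [p p0 <-]|_ [_ [p p0 <-] <-]].
  by exists (std_space b p); [exists p | rewrite image_id std].
by exists p; rewrite // image_id std.
Qed.
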